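(* The category of all sober dcpo's and Scott-continuous maps is not closed under products in the category of all dcpo's and Scott-continuous maps. Hence, the category of all sober dcpo's is not reflective in the category of all dcpo's and Scott-continuous maps.
   Context: A dcpo is a poset in which every directed (nonempty) subset has a supremum. A subset $U$ of a dcpo $P$ is Scott open if it is an upper set and, for every directed $D\subseteq P$, $\sup D\in U$ implies $D\cap U\neq\emptyset$; the Scott open sets form the Scott topology $\sigma(P)$. A map between dcpo's is Scott-continuous if it is continuous for the Scott topologies (equivalently, it preserves directed suprema). A $T_0$ space is sober if every nonempty irreducible closed subset is the closure of a unique singleton. A dcpo is called a sober dcpo if it is a sober space in its Scott topology. The category of sober dcpo's is regarded as a full subcategory of the category of dcpo's; products in the latter are the products of posets with the componentwise order. *)

(* Defs.v *)
From HB Require Import structures.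
From mathcomp Require Import all_boot all_order.
From mathcomp Require Import all_classical topology.

Set Implicit Arguments.
Unset Strict Implicit.
Unset Printing Implicit Defensive.

Import Order.TTheory.
Local Open Scope classical_set_scope.
Local Open Scope order_scope.

(* A full subcategory is given by a predicate on objects. *)
Record category := Category {
  obj :> Type;
  hom : obj -> obj -> Type;
  idm : forall X, hom X X;
  comp : forall X Y Z, hom Y Z -> hom X Y -> hom X Z;
  comp_idl : forall X Y (f : hom X Y), comp (idm Y) f = f;
  comp_idr : forall X Y (f : hom X Y), comp f (idm X) = f;
  compA : forall X Y Z W (h : hom Z W) (g : hom Y Z) (f : hom X Y),
    comp h (comp g f) = comp (comp h g) f
}.

Definition is_product (C : category) (I : Type) (X : I -> C) (P : C)
    (pi : forall i, hom P (X i)) : Prop :=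
  forall (Y : C) (f : forall i, hom Y (X i)),
    exists! h : hom Y P, forall i, comp (pi i) h = f i.

Definition closed_under_products (C : category) (S : C -> Prop) : Prop :=
  forall (I : Type) (X : I -> C) (P : C) (pi : forall i, hom P (X i)),
    (forall i, S (X i)) -> is_product pi -> S P.

(* The reflection [r : X -> Y] is a universal arrow from [X] to the inclusion
   functor; as the subcategory is full, [g] ranges over all of [hom Y Z]. *)
Definition reflective (C : category) (S : C -> Prop) : Prop :=
  forall X : C, exists (Y : C) (r : hom X Y), S Y /\
    forall Z : C, S Z -> forall f : hom X Z, exists! g : hom Y Z, comp g r = f.

Definition directed d (T : porderType d) (D : set T) : Prop :=
  D !=set0 /\
  forall x y, D x -> D y -> exists z, [/\ D z, x <= z & y <= z].

(* No least element is required, and a dcpo may be empty. *)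
HB.mixin Record POrder_isDcpo d T & Order.POrder d T := {
  directed_lub : forall D : set T, directed D -> exists s, isLub D s
}.

#[short(type="dcpoType")]
HB.structure Definition Dcpo d := {T of Order.POrder d T & POrder_isDcpo d T}.

Definition scott_open d (P : dcpoType d) (U : set P) : Prop :=
  (forall x y, x <= y -> U x -> U y) /\
  (forall (D : set P) (s : P), directed D -> isLub D s -> U s ->
     D `&` U !=set0).

(* [P] equipped with its Scott topology. *)
Definition scott d (P : dcpoType d) : Type := P.

Section ScottTopology.
Context d (P : dcpoType d).

Let scott_openT : scott_open (@setT P).
Proof.
by split=> [//|D s [[x Dx] _] _ _]; exists x.
Qed.

Let scott_openI : setI_closed (@scott_open d P).
Proof.
move=> A B [uA sA] [uB sB]; split=> [x y xy [Ax Bx]|D s dD ls [As Bs]].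
  by split; [exact: uA Ax|exact: uB Bx].
have [a [Da Aa]] := sA D s dD ls As.
have [b [Db Bb]] := sB D s dD ls Bs.
have [c [Dc ac bc]] := dD.2 a b Da Db.
by exists c; split=> //; split; [exact: uA Aa|exact: uB Bb].
Qed.

Let scott_open_bigU (I : Type) (f : I -> set P) :
  (forall i, scott_open (f i)) -> scott_open (\bigcup_i f i).
Proof.
move=> fo; split=> [x y xy [i _ fx]|D s dD ls [i _ fs]].
  by exists i => //; apply: (fo i).1 fx.
by have [x [Dx fx]] := (fo i).2 D s dD ls fs; exists x; split=> //; exists i.
Qed.

HB.instance Definition _ := Choice.on (scott P).
HB.instance Definition _ := isOpenTopological.Build (scott P)
  scott_openT scott_openI scott_open_bigU.

End ScottTopology.

Definition irreducible_set (T : topologicalType) (A : set T) : Prop :=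
  A !=set0 /\
  forall B C : set T, closed B -> closed C -> A `<=` B `|` C ->
    A `<=` B \/ A `<=` C.

Definition sober_space (T : topologicalType) : Prop :=
  kolmogorov_space T /\
  forall A : set T, closed A -> irreducible_set A ->
    exists! x : T, A = closure [set x].

(* The display of an order only drives notation, so one is fixed. *)
Notation dcpo := (dcpoType Order.default_display).

Section DcpoCategory.
Implicit Types X Y Z W : dcpo.

Definition dcpo_hom X Y : Type := continuousType (scott X) (scott Y).

Definition dcpo_id X : dcpo_hom X X := @idfun (scott X).

Definition dcpo_comp X Y Z (g : dcpo_hom Y Z) (f : dcpo_hom X Y) :
  dcpo_hom X Z := g \o f.

Let dcpo_comp_idl X Y (f : dcpo_hom X Y) : dcpo_comp (dcpo_id Y) f = f.
Proof. exact/continuousEP. Qed.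

Let dcpo_comp_idr X Y (f : dcpo_hom X Y) : dcpo_comp f (dcpo_id X) = f.
Proof. exact/continuousEP. Qed.

Let dcpo_compA X Y Z W (h : dcpo_hom Z W) (g : dcpo_hom Y Z)
  (f : dcpo_hom X Y) :
  dcpo_comp h (dcpo_comp g f) = dcpo_comp (dcpo_comp h g) f.
Proof. exact/continuousEP. Qed.

Definition DCPO : category :=
  Category dcpo_comp_idl dcpo_comp_idr dcpo_compA.

End DcpoCategory.

Definition sober_dcpo : DCPO -> Prop := fun P : dcpo => sober_space (scott P).

(* The remainder of the file shows that products in [DCPO] are the products of posets with
   the componentwise order. *)
Lemma scott_open_ngt (X : dcpo) (x : X) : scott_open [set z | ~~ (z <= x)].
Proof.
split=> [y z yz /negP yx|D s dD [ub lub] /negP sx].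
  by apply/negP => zx; apply: yx; exact: le_trans zx.
apply: contrapT => nD; apply: sx; apply: lub => z Dz.
by apply/negPn/negP => zx; apply: nD; exists z; split=> //; apply/negP.
Qed.

Section ScottContinuity.
Context (X Y : dcpo).

Lemma scott_continuous_homo (f : dcpo_hom X Y) :
  {homo (f : X -> Y) : x y / x <= y}.
Proof.
move=> x y xy; apply/negPn/negP => fxy.
have /continuousP/(_ _ (scott_open_ngt ((f : X -> Y) y))) [up _] := @cts_fun _ _ f.
by have := up x y xy fxy; rewrite /= lexx.
Qed.

Lemma scott_continuousP (f : X -> Y) :
  continuous (f : scott X -> scott Y) <->
  forall (D : set X) (s : X), directed D -> isLub D s -> isLub (f @` D) (f s).
Proof.
split=> [cf D s dD [ub lub]|fD].
  have fm := @scott_continuous_homo (mkcts cf).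
  split=> [_ [x Dx <-]|b bub]; first exact/fm/ub.
  apply/negPn/negP => fsb.
  have /continuousP/(_ _ (scott_open_ngt b)) [_ sD] := cf.
  have [x [Dx /negP]] := sD D s dD (conj ub lub) fsb.
  by apply; apply: bub; exists x.
have fm : {homo f : x y / x <= y}.
  move=> x y xy.
  have dxy : directed [set x; y].
    split=> [|a b [->|->] [->|->]]; first by exists x; left.
    - by exists x; split=> //; left.
    - by exists y; split=> //; right.
    - by exists y; split=> //; right.
    - by exists y; split=> //; right.
  have lxy : isLub [set x; y] y.
    by split=> [a [->|->] //|b]; apply; right.
  by have [ub _] := fD _ _ dxy lxy; apply: ub; exists x => //; left.
apply/continuousP => U [up sU]; split=> [x y xy|D s dD ls Us].
  by apply: up; exact: fm.
have [|_ [[x Dx <-] Ux]] := sU (f @` D) (f s) _ (fD _ _ dD ls) Us.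
  split; first by case: dD => [[x Dx] _]; exists (f x), x.
  move=> _ _ [x Dx <-] [y Dy <-].
  have [z [Dz xz yz]] := dD.2 x y Dx Dy.
  by exists (f z); split; [exists z|exact: fm|exact: fm].
by exists x.
Qed.

End ScottContinuity.

Definition dcpo_prod (I : Type) (X : I -> dcpo) : Type := forall i, X i.

Section DcpoProduct.
Context (I : Type) (X : I -> dcpo).
Local Notation P := (dcpo_prod X).

Definition prod_le (f g : P) : bool := `[< forall i, f i <= g i >].

Let prod_le_refl : reflexive prod_le.
Proof. by move=> f; apply/asboolP => i. Qed.

Let prod_le_anti : antisymmetric prod_le.
Proof.
move=> f g /andP[/asboolP fg /asboolP gf]; apply: functional_extensionality_dep.
by move=> i; apply: le_anti; rewrite fg gf.
Qed.

Let prod_le_trans : transitive prod_le.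
Proof.
move=> g f h /asboolP fg /asboolP gh; apply/asboolP => i.
exact: le_trans (fg i) (gh i).
Qed.

HB.instance Definition _ := Choice.copy P (forall i, X i).
HB.instance Definition _ := Order.Le_isPOrder.Build Order.default_display P
  prod_le_refl prod_le_anti prod_le_trans.

Lemma dcpo_prod_leP (f g : P) : (f <= g) <-> (forall i, f i <= g i).
Proof. by split=> /asboolP. Qed.

Let directed_proj (D : set P) i : directed D -> directed [set f i | f in D].
Proof.
move=> [[f Df] dD]; split; first by exists (f i), f.
move=> _ _ [g Dg <-] [h Dh <-].
have [k [Dk /dcpo_prod_leP gk /dcpo_prod_leP hk]] := dD g h Dg Dh.
by exists (k i); split; [exists k|exact: gk|exact: hk].
Qed.

Let isLub_prod (D : set P) (s : P) :
  (forall i, isLub [set f i | f in D] (s i)) -> isLub D s.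
Proof.
move=> ls; split=> [f Df|b bub]; apply/dcpo_prod_leP => i.
  by apply: (ls i).1; exists f.
apply: (ls i).2 => _ [f Df <-].
exact: ((dcpo_prod_leP f b).1 (bub f Df) i).
Qed.

Let dcpo_prod_lub (D : set P) : directed D -> exists s, isLub D s.
Proof.
move=> dD.
exists (fun i => projT1 (cid (directed_lub _ (directed_proj i dD)))).
by apply: isLub_prod => i; exact: projT2 (cid _).
Qed.

HB.instance Definition _ :=
  POrder_isDcpo.Build Order.default_display P dcpo_prod_lub.

Let proj_continuous i : continuous (fun f : scott P => f i : scott (X i)).
Proof.
apply/scott_continuousP => D s dD ls.
pose t : P := fun j => projT1 (cid (directed_lub _ (directed_proj j dD))).
have lt j : isLub [set f j | f in D] (t j) by exact: projT2 (cid _).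
suff -> : s = t by exact: lt.
have [ub lub] := ls; have [ub' lub'] := isLub_prod lt.
by apply/eqP; rewrite eq_le lub //= lub'.
Qed.

Definition dcpo_proj i : dcpo_hom P (X i) := mkcts (@proj_continuous i).

Lemma dcpo_prod_is_product : @is_product DCPO I X P dcpo_proj.
Proof.
move=> Y f.
pose h (y : Y) : P := fun i => (f i : Y -> X i) y.
have hc : continuous (h : scott Y -> scott P).
  apply/scott_continuousP => D s dD ls; apply: isLub_prod => i.
  have /scott_continuousP/(_ D s dD ls) := @cts_fun _ _ (f i).
  by rewrite image_comp.
exists (mkcts hc : dcpo_hom Y P); split=> [i|g gf]; first exact/continuousEP.
apply/continuousEP => y; apply: functional_extensionality_dep => i.
exact: (esym (proj1 (continuousEP _ _) (gf i) y)).
Qed.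

End DcpoProduct.

(* Main.v *)
(* Both factors are dcpos with a top element, a common antichain of "tips" and
   countable chains converging to tips or to the top; each term of a chain lies
   below its limit, below the next terms and below a prescribed set of tips.
   The tips are the pairs (z, n) with z : nat -> nat; such a z codes two parents
   at level n - 1, each with a number.
   - In the left dcpo L the m-th term of the chain at (z, n) lies below the
     children of (z, n) which number it at least m. Sequences of tips of
     increasing level are made to converge to the top, so a closed set avoiding
     the top has tips of bounded level, and its tips of maximal level are
     isolated.
   - In the right dcpo R the children of (z, n) with a fixed number for (z, n)
     converge to (z, n) when the other parent goes to infinity. Sequences of
     tips of one level with pairwise disjoint parents are made to converge to
     the top, so in a closed set avoiding the top finitely many parents suffice
     to cover each level; this makes its tips separated by open sets.
   Hence L and R are sober. In L x R the down-closure A of the pairs (e, e), with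
   e a tip, is Scott closed. If (e, e) belongs to an open set U, going first
   down the chain of e in L and then down the chains of R shows that (c, c) is
   in U for all children c of e with a given number for e, up to finitely many
   values of the other parent. As there are uncountably many tips, any two such
   families have a common member two levels further up, so A is irreducible; it
   is not principal. Finally a reflective subcategory closed under isomorphism
   is closed under products. *)

From HB Require Import structures.
From mathcomp Require Import all_boot all_order.
From mathcomp Require Import all_classical topology.
From mathcomp Require Import zify.
Require Import Defs.

Set Implicit Arguments.
Unset Strict Implicit.
Unset Printing Implicit Defensive.

Import Order.TTheory.
Local Open Scope order_scope.
Local Open Scope classical_set_scope.

(** * Scott closed sets and sobriety *)

Section ScottClosed.
Context (P : dcpo).
Implicit Types (A D : set P) (x y s : P).

Definition scott_closed A :=
  (forall x y, x <= y -> A y -> A x) /\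
  (forall D s, directed D -> isLub D s -> D `<=` A -> A s).

Lemma scott_closedP A : closed (A : set (scott P)) <-> scott_closed A.
Proof.
rewrite -openC; split=> [[up sup]|[low lub]]; split.
- by move=> x y xy Ay; apply: contrapT => nAx; exact: (up x y xy nAx).
- move=> D s dD ls DA; apply: contrapT => nAs.
  by have [x [Dx]] := sup D s dD ls nAs; apply; exact: DA.
- by move=> x y xy nAx Ay; apply: nAx; exact: low Ay.
- move=> D s dD ls nAs; apply: contrapT => nD; apply: nAs.
  apply: lub dD ls _ => x Dx; apply: contrapT => nAx; apply: nD.
  by exists x; split.
Qed.

Lemma principal_scott_closed x : scott_closed [set y | y <= x].
Proof.
split=> [y z yz /(le_trans yz) //|D s _ [_ lub] Dx].
by apply: lub => y /Dx.
Qed.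

Lemma scott_closure1 x :
  closure ([set x] : set (scott P)) = [set y : P | y <= x].
Proof.
apply/seteqP; split=> [y|y yx].
  suff sub : closure ([set x] : set (scott P)) `<=` [set y : P | y <= x].
    exact: sub.
  have /scott_closedP cx := principal_scott_closed x.
  rewrite (iffLR (closure_id _) cx); apply: closure_subset => _ ->.
  exact: lexx.
have [low _] : scott_closed (closure ([set x] : set (scott P))).
  by apply/scott_closedP; exact: closed_closure.
by apply: low yx _; exact: subset_closure.
Qed.

Lemma scott_sober_point A : sober_space (scott P) -> scott_closed A ->
  irreducible_set (A : set (scott P)) -> exists x, A = [set y | y <= x].
Proof.
move=> [_ sP] /scott_closedP cA iA; have [x [Ax _]] := sP A cA iA.
by exists x; rewrite Ax scott_closure1.
Qed.

(** Complements of principal ideals are Scott open, so T0 separation and uniqueness of the generic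
    point follow from antisymmetry. *)
Lemma scott_soberI :
  (forall A, scott_closed A -> irreducible_set (A : set (scott P)) ->
     exists x, A = [set y | y <= x]) ->
  sober_space (scott P).
Proof.
move=> sP; split=> [x y xy|A /scott_closedP cA iA].
  have sep (a b : P) : ~~ (a <= b) ->
      exists U : set (scott P), U \in nbhs (a : scott P) /\ (b : scott P) \in ~` U.
    move=> ab; exists [set z : P | ~~ (z <= b)]; rewrite !inE; split.
      exact: (@open_nbhs_nbhs (scott P)) (conj (scott_open_ngt b) ab).
    by move=> /= /negP; apply; exact: (@lexx _ P).
  case: (boolP ((x : P) <= (y : P))) => xley; last first.
    by have [U ?] := sep _ _ xley; exists U; left.
  case: (boolP ((y : P) <= (x : P))) => yx; last first.
    by have [U ?] := sep _ _ yx; exists U; right.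
  have e : (x : P) = (y : P) by apply/eqP; rewrite (@eq_le _ P) xley yx.
  by case/eqP: xy.
have [x Ax] := sP A cA iA; exists x; split=> [|y]; first by rewrite scott_closure1.
rewrite scott_closure1 Ax => /seteqP[xy yx].
have le_xy : (x : P) <= (y : P) by apply: xy; exact: (@lexx _ P).
have le_yx : (y : P) <= (x : P) by apply: yx; exact: (@lexx _ P).
by apply/eqP; rewrite (@eq_le _ P) le_xy le_yx.
Qed.

End ScottClosed.

(** * Reflective subcategories and products *)

Section Isomorphism.
Context (P Y : dcpo) (r : dcpo_hom P Y) (g : dcpo_hom Y P).

Lemma scott_closed_preimage (X Z : dcpo) (f : dcpo_hom X Z) (A : set Z) :
  scott_closed A -> scott_closed ((f : X -> Z) @^-1` A).
Proof.
move=> /scott_closedP cA; apply/scott_closedP.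
by apply: (preimage_closed (f := f : scott X -> scott Z)) cA => x _; exact: cts_fun.
Qed.

Lemma sober_iso : (forall x : P, (g : Y -> P) ((r : P -> Y) x) = x) ->
  (forall y : Y, (r : P -> Y) ((g : Y -> P) y) = y) ->
  sober_space (scott Y) -> sober_space (scott P).
Proof.
move=> rK gK sY; apply: scott_soberI => A cA [[a Aa] iA].
have [|y gA] := scott_sober_point sY (scott_closed_preimage g cA).
  split=> [|B C /scott_closedP cB /scott_closedP cC AB].
    by exists ((r : P -> Y) a); rewrite /= rK.
  have pre (B' : set Y) : scott_closed B' ->
      closed ((r : P -> Y) @^-1` B' : set (scott P)).
    by move=> ?; apply/scott_closedP; exact: scott_closed_preimage.
  have [x Ax|sB|sC] := iA _ _ (pre B cB) (pre C cC).
  - by apply: AB; rewrite /= rK.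
  - by left=> y /sB; rewrite /= gK.
  - by right=> y /sC; rewrite /= gK.
exists ((g : Y -> P) y); apply/seteqP; split=> x.
  rewrite -{1}(rK x) => Ax; have : (r : P -> Y) x <= y.
    by have : ((g : Y -> P) @^-1` A) ((r : P -> Y) x) by []; rewrite gA.
  by move=> /(scott_continuous_homo g); rewrite rK.
move=> /= /cA.1; apply.
by suff : ((g : Y -> P) @^-1` A) y by []; rewrite gA; exact: (@lexx _ Y).
Qed.

End Isomorphism.

(** The projections factor through the reflection [r], and the factors induce [g] back into the
    product. Uniqueness for the product, then for [r], makes [g] and [r] mutually inverse. *)
Lemma reflective_closed_under_products : reflective sober_dcpo ->
  closed_under_products sober_dcpo.
Proof.
move=> refl I X P pi SX prod.
have [Y [r [SY univ]]] := refl P.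
have fact i : exists g : hom Y (X i), comp g r = pi i.
  by have [g [gr _]] := univ (X i) (SX i) (pi i); exists g.
pose f i := sval (cid (fact i)).
have fr i : comp (f i) r = pi i := svalP (cid (fact i)).
have [g [gf _]] := prod Y f.
have gr : comp g r = idm P.
  have [h [_ hP]] := prod P pi.
  rewrite -(hP (comp g r)) => [|i]; last by rewrite compA gf fr.
  by apply: hP => i; rewrite comp_idr.
have rg : comp r g = idm Y.
  have [h [_ hP]] := univ Y SY r.
  rewrite -(hP (comp r g)); last by rewrite -compA gr comp_idr.
  by apply: hP; rewrite comp_idl.
apply: (sober_iso (r := r) (g := g)) SY => x.
  exact: (iffLR (continuousEP _ _) gr x).
exact: (iffLR (continuousEP _ _) rg x).
Qed.

(** * Fans: dcpos made of tips and chains *)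

(* [flim s = None] means that the chain indexed by [s] converges to the top
   element of the dcpo, and [freach s m] is the set of tips above its [m]-th
   term. *)
Record fan_shape := FanShape {
  ftip : Type;
  fstem : Type;
  flim : fstem -> option ftip;
  freach : fstem -> nat -> set ftip;
  freach_anti : forall s m n, (m <= n)%N -> freach s n `<=` freach s m;
  freach_lim : forall s e, flim s = Some e <-> forall m, freach s m e
}.

Inductive fan (F : fan_shape) : Type :=
| Top
| Tip of ftip F
| Stem of fstem F & nat.
Arguments Top {F}.

Section FanOrder.
Context (F : fan_shape).
Implicit Types (x y z : fan F) (e : ftip F) (s : fstem F) (m n : nat).

Definition fan_le_prop x y : Prop :=
  match y, x with
  | Top, _ => True
  | Tip e', Tip e => e = e'
  | Tip e, Stem s m => freach s m e
  | Stem s' n, Stem s m => s = s' /\ (m <= n)%N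
  | _, _ => False
  end.

Definition fan_le x y : bool := `[< fan_le_prop x y >].

Let fan_le_refl : reflexive fan_le.
Proof. by case=> [|e|s m]; apply/asboolP. Qed.

Let fan_le_anti : antisymmetric fan_le.
Proof.
move=> x y /andP[/asboolP + /asboolP].
case: x y => [|e|s m] [|e'|s' n] //=; first by move=> ->.
by move=> [-> mn] [_ nm]; congr Stem; lia.
Qed.

Let fan_le_trans : transitive fan_le.
Proof.
move=> y x z /asboolP + /asboolP + ; move=> xy yz; apply/asboolP; move: xy yz.
case: x y z => [|e|s m] [|e'|s' n] [|e''|s'' k] //=.
- by move=> ->.
- by move=> + <-.
- by move=> [-> mn]; exact: freach_anti.
- by move=> [-> mn] [-> nk]; split=> //; exact: leq_trans nk.
Qed.

HB.instance Definition _ := gen_eqMixin (fan F).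
HB.instance Definition _ := gen_choiceMixin (fan F).
HB.instance Definition _ := Order.Le_isPOrder.Build Order.default_display
  (fan F) fan_le_refl fan_le_anti fan_le_trans.

Lemma fan_leE x y : (x <= y) <-> fan_le_prop x y.
Proof. by split=> /asboolP. Qed.

Definition fan_lim s : fan F := if flim s is Some e then Tip e else Top.

Lemma stem_le_lim s m : Stem s m <= fan_lim s.
Proof.
rewrite /fan_lim; case E : (flim s) => [e|]; apply/fan_leE => //=.
exact: (iffLR (freach_lim s e) E).
Qed.

Lemma stem_cofinal_lub (D : set (fan F)) s :
  D `<=` range (Stem s) -> (forall m, exists2 n, (m <= n)%N & D (Stem s n)) ->
  isLub D (fan_lim s).
Proof.
move=> sD cD; split=> [x /sD[m _ <-]|b bD]; first exact: stem_le_lim.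
have sb m : fan_le_prop (Stem s m) b.
  have [n mn /bD nb] := cD m; apply/fan_leE; apply: le_trans nb.
  by apply/fan_leE.
case: b {bD} sb => [_|e sb|s' m sb]; first exact/fan_leE.
  by rewrite /fan_lim (iffRL (freach_lim s e) sb); apply/fan_leE.
by have /= [_] := sb m.+1; rewrite ltnn.
Qed.

(** Only the top lies strictly above a tip, so a directed set without maximum contains neither the
    top nor a tip; directedness then keeps it in one chain. *)
Lemma fan_directed (D : set (fan F)) : directed D ->
  (exists2 x, D x & ubound D x) \/
  (exists s, D `<=` range (Stem s) /\
     forall m, exists2 n, (m <= n)%N & D (Stem s n)).
Proof.
move=> [[x0 Dx0] dD]; have [?|nmax] := pselect (exists2 x, D x & ubound D x).
  by left.
right; have up x : D x -> exists2 y, D y & ~~ (y <= x).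
  move=> Dx; apply: contrapT => ny; apply: nmax; exists x => // y Dy.
  by apply: contrapT => /negP yx; apply: ny; exists y.
have nTop : ~ D Top by move=> /up[y _ /negP]; apply; exact/fan_leE.
have nTip e : ~ D (Tip e).
  move=> De; have [y Dy /negP] := up _ De; apply.
  have [z [Dz /fan_leE ez yz]] := dD _ _ De Dy.
  by case: z Dz ez yz => [/nTop //|e' _ /= ->|//].
have stem x : D x -> exists s m, x = Stem s m.
  by case: x => [/nTop //|e /nTip //|s m _]; exists s, m.
have [s [m0 x0E]] := stem x0 Dx0; rewrite {}x0E in Dx0; exists s.
have sD : D `<=` range (Stem s).
  move=> x Dx; have [s' [m xE]] := stem x Dx; rewrite {}xE in Dx *.
  have [z [Dz /fan_leE sz /fan_leE s'z]] := dD _ _ Dx0 Dx.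
  by case: z Dz sz s'z => [/nTop //|e /nTip //|s'' k _ /= [-> _] [-> _]]; exists m.
split=> // m; elim: m => [|m [n mn Dn]]; first by exists m0.
have [y Dy /negP yn] := up _ Dn; have [k _ yE] := sD y Dy.
exists k; last by rewrite yE.
rewrite ltnNge; apply/negP => km; apply: yn.
by rewrite -yE; apply/fan_leE; split=> //; exact: leq_trans mn.
Qed.

Let fan_directed_lub (D : set (fan F)) : directed D -> exists x, isLub D x.
Proof.
move=> /fan_directed[[x Dx xD]|[s [sD cD]]].
  by exists x; split=> // b; exact.
by exists (fan_lim s); exact: stem_cofinal_lub.
Qed.

HB.instance Definition _ :=
  POrder_isDcpo.Build Order.default_display (fan F) fan_directed_lub.

Lemma fan_scott_closedP (A : set (fan F)) : scott_closed A <->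
  (forall x y, x <= y -> A y -> A x) /\
  (forall s, (forall m, A (Stem s m)) -> A (fan_lim s)).
Proof.
split=> -[low lub]; split=> //.
  move=> s sA; have ls : isLub (range (Stem s)) (fan_lim s).
    by apply: stem_cofinal_lub => // m; exists m => //; exists m.
  apply: lub ls _; last by move=> _ [m _ <-].
  split; first by exists (Stem s 0), 0%N.
  move=> _ _ [m _ <-] [n _ <-]; exists (Stem s (maxn m n)); split.
  - by exists (maxn m n).
  - by apply/fan_leE; split=> //; exact: leq_maxl.
  - by apply/fan_leE; split=> //; exact: leq_maxr.
move=> D x dD [ub lx] DA; have [[y Dy yD]|[s [sD cD]]] := fan_directed dD.
  by apply: low (DA y Dy); exact: lx.
have [ub' _] := stem_cofinal_lub sD cD.
apply: (low _ _ (lx _ ub')); apply: lub => m.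
have [n mn /DA] := cD m; apply: low; exact/fan_leE.
Qed.

Section Sober.
(** [K] stands for the tips of a Scott closed set avoiding the top; the last clause says that [U]
    and [V] are open relative to [K]. *)
Hypothesis sep : forall K : set (ftip F),
  (forall s, (forall m, exists2 e, K e & freach s m e) ->
     exists2 e, flim s = Some e & K e) ->
  (exists e1 e2, [/\ K e1, K e2 & e1 <> e2]) ->
  exists U V : set (ftip F), [/\ K `&` U !=set0, K `&` V !=set0,
    U `&` V = set0 &
    forall W, W = U \/ W = V -> forall s e, flim s = Some e -> W e ->
      exists m, freach s m `&` K `<=` W].

Lemma fan_sober : sober_space (scott (fan F)).
Proof.
apply: scott_soberI => A cA [[x0 Ax0] iA].
have {iA} iA (B C : set (fan F)) : scott_closed B -> scott_closed C ->
    A `<=` B `|` C -> A `<=` B \/ A `<=` C.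
  by move=> /scott_closedP cB /scott_closedP cC; exact: iA.
have /fan_scott_closedP[low lub] := cA.
have [AT|nAT] := pselect (A Top).
  exists Top; apply/seteqP; split=> x _; first exact/fan_leE.
  by apply: low AT; exact/fan_leE.
(* Removing a chain term maximal in [A] keeps [A] closed, as limits are never chain terms; by
   irreducibility that term generates [A]. *)
have [[s [m [Asm smax]]]|nmax] := pselect (exists s m,
    A (Stem s m) /\ forall y, A y -> Stem s m <= y -> y = Stem s m).
  exists (Stem s m); apply/seteqP; split; last by move=> x /low; apply.
  have cB : scott_closed (A `\ Stem s m).
    apply/fan_scott_closedP; split=> [x y xy [Ay ysm]|s' As'].
      split; first exact: low xy Ay.
      by move=> /= xE; apply/ysm/smax => //; rewrite -xE.
    split; first by apply: lub => k; exact: (As' k).1.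
    by rewrite /fan_lim /=; case: flim.
  have [|AB|//] := iA _ _ cB (principal_scott_closed (Stem s m)).
    move=> x Ax; have [->|xsm] := pselect (x = Stem s m); last by left.
    by right; exact: (@lexx _ (fan F)).
  by have [_ []] := AB _ Asm.
pose K := [set e | A (Tip e)].
(* Without a tip of [K] above it, the term could be followed up its chain forever inside [A]; the
   limit would then be such a tip. *)
have reach s m : A (Stem s m) -> exists2 e, K e & freach s m e.
  move=> Asm; apply: contrapT => nK.
  have As k : A (Stem s (m + k)).
    elim: k => [|k Ak]; first by rewrite addn0.
    apply: contrapT => nA; apply: nmax; exists s, (m + k)%N; split=> // y Ay.
    move=> /fan_leE; case: y Ay => [//|e Ae /= ske|s' j Aj /= [ss' kj]].
      by case: nK; exists e => //; apply: freach_anti ske; exact: leq_addr.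
    rewrite -ss' in Aj *; congr Stem; apply/eqP; rewrite eqn_leq kj andbT.
    rewrite leqNgt; apply/negP => kj'; apply: nA.
    by apply: low Aj; apply/fan_leE; split=> //; rewrite addnS.
  have : A (fan_lim s).
    apply: lub => k; apply: low (As k); apply/fan_leE; split=> //.
    exact: leq_addl.
  rewrite /fan_lim; case E: (flim s) => [e|//] Ae; apply: nK; exists e => //.
  exact: (iffLR (freach_lim s e) E).
have cK s : (forall m, exists2 e, K e & freach s m e) ->
    exists2 e, flim s = Some e & K e.
  move=> sK; have : A (fan_lim s).
    by apply: lub => m; have [e Ke sme] := sK m; apply: low Ke; exact/fan_leE.
  by rewrite /fan_lim; case: (flim s) => [e|//] ?; exists e.
have AK x : A x -> exists2 e, K e & x <= Tip e.
  case: x => [//|e Ae|s m /reach[e Ke sme]].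
    by exists e => //; exact: (@lexx _ (fan F)).
  by exists e => //; exact/fan_leE.
have [[e1 [e2 [Ke1 Ke2 e12]]]|one] :=
    pselect (exists e1 e2, [/\ K e1, K e2 & e1 <> e2]); last first.
  have [e Ke x0e] := AK x0 Ax0; exists (Tip e).
  apply/seteqP; split=> [x /AK[e' Ke' xe']|x /low]; last exact.
  suff -> : e = e' by [].
  by apply: contrapT => ee'; apply: one; exists e, e'.
have [U [V [[u [Ku Uu]] [v [Kv Vv]] UV WP]]] := sep cK
  (ex_intro _ e1 (ex_intro _ e2 (And3 Ke1 Ke2 e12))).
(* [B U] and [B V] are closed and cover [A], but neither contains [A]. *)
pose B W := [set x | exists e, [/\ K e, ~ W e & x <= Tip e]].
have cB W : W = U \/ W = V -> scott_closed (B W).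
  move=> /WP WW; apply/fan_scott_closedP; split.
    by move=> x y xy [e [Ke We ye]]; exists e; split=> //; exact: le_trans ye.
  move=> s sB; have [|e se Ke] := cK s.
    by move=> m; have [e [Ke _ /fan_leE sme]] := sB m; exists e.
  exists e; split=> //; last first.
    by rewrite /fan_lim se; exact: (@lexx _ (fan F)).
  move=> /(WW s e se)[m mW]; have [e' [Ke' We' /fan_leE sme']] := sB m.
  by apply: We'; apply: mW.
have AB e W : A `<=` B W -> K e -> ~ W e.
  by move=> sub /sub[e' [_ We' /fan_leE /= ->]].
have [|AU|AV] := iA _ _ (cB U (or_introl erefl)) (cB V (or_intror erefl)).
- move=> x /AK[e Ke xe]; have [Ue|nUe] := pselect (U e); last first.
    by left; exists e.
  right; exists e; split=> // Ve.
  by have : (U `&` V) e by []; rewrite UV.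
- by case: (AB u U AU Ku).
- by case: (AB v V AV Kv).
Qed.

End Sober.
End FanOrder.

(* If no finite [S] works, there is a sequence of [v]'s with pairwise disjoint
   [g v]'s; [t] then records on [g v] the maximum of its index and of [a v]. *)
Lemma finite_coverI (X V : choiceType) (Q : V -> Prop) (g : V -> seq X)
    (a : V -> nat) :
  (forall t : X -> nat, exists k, forall v, Q v ->
     ~ (forall x, x \in g v -> (k <= t x)%N /\ (a v <= t x)%N)) ->
  exists S : seq X, forall v, Q v -> exists2 x, x \in g v & x \in S.
Proof.
move=> Qt; apply: contrapT => nS.
have /choice[f fP] (S : seq X) :
    exists v, Q v /\ forall x, x \in g v -> x \notin S.
  apply: contrapT => nv; apply: nS; exists S => v Qv; apply: contrapT => nx.
  apply: nv; exists v; split=> // x xv; apply/negP => xS; apply: nx.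
  by exists x.
pose S := fix S j := if j is j'.+1 then g (f (S j')) ++ S j' else [::].
have mono i j x : (i <= j)%N -> x \in S i -> x \in S j.
  elim: j => [|j IH]; first by rewrite leqn0 => /eqP ->.
  rewrite leq_eqVlt => /orP[/eqP -> //|/IH SS /SS xj].
  by rewrite /= mem_cat xj orbT.
pose v j := f (S j).
have disj i j x : x \in g (v i) -> x \in g (v j) -> i = j.
  wlog ij : i j / (i < j)%N => [wl xi xj|xi /(fP (S j)).2/negP[]].
    by have [/wl|/wl|//] := ltngtP i j; [exact|move=> /(_ xj xi)].
  by apply: (mono i.+1) => //=; rewrite mem_cat xi.
pose t x := if pselect (exists j, x \in g (v j)) is left e
  then maxn (sval (cid e)) (a (v (sval (cid e)))) else 0%N.
have tE j x : x \in g (v j) -> t x = maxn j (a (v j)).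
  move=> xj; rewrite /t; case: pselect => [e|[]]; last by exists j.
  by case: cid => i xi /=; rewrite (disj _ _ _ xi xj).
have [k /(_ (v k) (fP _).1)[]] := Qt t.
by move=> x /tE ->; rewrite leq_maxl leq_maxr.
Qed.

(** * Codes and growing sets of nodes *)

Definition code : Type := nat -> nat.
HB.instance Definition _ := Choice.on code.

(** Entries 0 and 1 hold the numbers of the two parents; the later entries interleave the parents
    themselves. *)
Definition num (b : bool) (v : code) : nat := v b.
Definition par (b : bool) (v : code) : code := fun k => v (b + k.*2).+2.

Lemma code_join (b : bool) (z w : code) (m k : nat) :
  exists v, [/\ par b v = z, num b v = m, par (~~ b) v = w & num (~~ b) v = k].
Proof.
exists (fun i => if i is j.+2 then (if odd j == b then z else w) j./2
  else if i == b :> nat then m else k).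
split; rewrite /par /num.
- by apply/funext => i /=; rewrite oddD odd_double addbF; case: b => /=;
    rewrite ?uphalf_double ?doubleK.
- by case: b.
- by apply/funext => i /=; rewrite oddD odd_double addbF; case: b => /=;
    rewrite ?uphalf_double ?doubleK.
- by case: b.
Qed.

(** Cantor's diagonal: entry [i] of [w] exceeds entry [i] of every code in [S i]. *)
Lemma code_diagonal (S : nat -> seq code) : exists w, forall i, w \notin S i.
Proof.
exists (fun i => (\max_(v <- S i) v i).+1) => i; apply/negP => wS.
have := @leq_bigmax_seq _ _ predT (fun v : code => v i) _ wS isT.
by rewrite ltnn.
Qed.

(** The property that Scott open sets of the product induce on diagonal tips, by [dtip_grows]. *)
Definition grows (O : set (code * nat)) : Prop :=
  forall z n, O (z, n) -> exists m, forall b, exists S : seq code, forall v,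
    par b v = z -> num b v = m -> par (~~ b) v \notin S -> O (v, n.+1).

Lemma grows_level O z n k : grows O -> O (z, n) -> exists z', O (z', n + k)%N.
Proof.
move=> gO Oz; elim: k => [|k [z' /gO[m /(_ false)[S SO]]]].
  by exists z; rewrite addn0.
have [w wS] := code_diagonal (fun=> S).
have [v [vz vm vw _]] := code_join false z' w m 0.
by exists v; rewrite addnS; apply: SO => //; rewrite vw; exact: (wS 0%N).
Qed.

Lemma grows_meet O O' : grows O -> grows O' -> O !=set0 -> O' !=set0 ->
  O `&` O' !=set0.
Proof.
move=> gO gO' [[z0 n0] Oz0] [[z0' n0'] Oz0'].
have [z Oz] := grows_level n0' gO Oz0.
have [z' Oz'] := grows_level n0 gO' Oz0'.
rewrite [(n0' + n0)%N]addnC in Oz'; move: (n0 + n0')%N => n in Oz Oz'.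
have [m /(_ false)[S SO]] := gO _ _ Oz.
have [w wS] := code_diagonal (fun=> S).
have /choice[v vP] i := code_join false z w m i.
have Ov i : O (v i, n.+1).
  have [vz vm vw _] := vP i.
  by apply: SO => //; rewrite vw; exact: (wS 0%N).
have /choice[mv /choice[F FO]] i : exists mi, exists Si : seq code, forall u,
    par false u = v i -> num false u = mi -> par true u \notin Si -> O (u, n.+2).
  by have [mi /(_ false)[Si ?]] := gO _ _ (Ov i); exists mi, Si.
have [m' /(_ true)[S' SO']] := gO' _ _ Oz'.
(* The index [i] is fixed only after [v'], so [w'] has to escape the images of all [F i] at once,
   besides [S']. *)
have [w' w'S] := code_diagonal
  (fun i => if i is j.+1 then map (par false) (F j) else S').
have [v' [v'z v'm v'w _]] := code_join true z' w' m' 0.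
have Ov' : O' (v', n.+1) by apply: SO' => //; rewrite v'w; exact: (w'S 0%N).
have v'F i : v' \notin F i.
  by apply/negP => /(map_f (par false)); rewrite v'w; apply/negP/(w'S i.+1).
have [m'' /(_ true)[S'' SO'']] := gO' _ _ Ov'.
(* [v i] gives its parent [w] the number [i], so a large [i] keeps it out of [S'']. *)
pose i := (\max_(u <- S'') num true u).+1.
have vS : v i \notin S''.
  have [_ _ _ /= vi] := vP i.
  apply/negP => vS; have := @leq_bigmax_seq _ _ predT (num true) _ vS isT.
  by rewrite vi ltnn.
have [u [uv um uv' um']] := code_join false (v i) v' (mv i) m''.
exists (u, n.+2); split.
  by apply: (FO i) => //; rewrite uv'; exact: v'F.
by apply: SO'' => //=; rewrite uv.
Qed.

(** * The left and right fans and their sobriety *)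

Local Notation node := (code * nat)%type.

Inductive lstem := LNode of node | LLevels of (nat -> code).

Definition llim (s : lstem) : option node :=
  if s is LNode e then Some e else None.

Definition lreach (s : lstem) (m : nat) : set node :=
  match s with
  | LNode e => [set x | x = e \/
      x.2 = e.2.+1 /\ exists b, par b x.1 = e.1 /\ (m <= num b x.1)%N]
  | LLevels h => [set x | (m <= x.2)%N /\ x.1 = h x.2]
  end.

Lemma lreach_anti s m n : (m <= n)%N -> lreach s n `<=` lreach s m.
Proof.
case: s => [e|h] mn x /=.
  move=> [->|[xe [b [bx nb]]]]; first by left.
  by right; split=> //; exists b; split=> //; exact: leq_trans nb.
by move=> [nx ->]; split=> //; exact: leq_trans nx.
Qed.

Lemma llimP s e : llim s = Some e <-> forall m, lreach s m e.
Proof.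
case: s => [e'|h] /=; split=> //.
- by move=> [->] m; left.
- move=> H; have [->//|[_ [b0 _]]] := H 0%N.
  have [->//|[_ [b [_ nb]]]] := H (num false e.1 + num true e.1).+1.
  by exfalso; case: b nb => nb; lia.
- by move=> /(_ e.2.+1)[]; rewrite ltnn.
Qed.

Definition lshape := FanShape lreach_anti llimP.

Inductive rstem :=
| RNode of bool & node & nat & (code -> nat)
| RLevel of nat & (code -> nat).

Definition rlim (s : rstem) : option node :=
  if s is RNode _ e _ _ then Some e else None.

(* The functions [t] play the role of sequences: a chain indexed by [t]
   approaches its limit along those nodes whose parents have large [t]-value;
   the bound on [num] leaves finitely many choices of [num] for each parent. *)
Definition rreach (s : rstem) (k : nat) : set node :=
  match s with
  | RNode b e i t => [set x | x = e \/
      [/\ x.2 = e.2.+1, par b x.1 = e.1, num b x.1 = i,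
          (k <= t (par (~~ b) x.1))%N &
          (num (~~ b) x.1 <= t (par (~~ b) x.1))%N]]
  | RLevel n t => [set x | x.2 = n.+1 /\ forall b,
      (k <= t (par b x.1))%N /\ (num b x.1 <= t (par b x.1))%N]
  end.

Lemma rreach_anti s m n : (m <= n)%N -> rreach s n `<=` rreach s m.
Proof.
case: s => [b e i t|l t] mn x /=.
  move=> [->|[xe bx ni nt bt]]; first by left.
  by right; split=> //; exact: leq_trans nt.
by move=> [xl tb]; split=> // b; have [nt ?] := tb b; split=> //; exact: leq_trans nt.
Qed.

Lemma rlimP s e : rlim s = Some e <-> forall m, rreach s m e.
Proof.
case: s => [b e' i t|l t] /=; split=> //.
- by move=> [->] m; left.
- move=> /(_ (t (par (~~ b) e.1)).+1)[->//|[_ _ _]].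
  by rewrite ltnn.
- by move=> /(_ (t (par false e.1)).+1)[_ /(_ false)[]]; rewrite ltnn.
Qed.

Definition rshape := FanShape rreach_anti rlimP.

(** For [k] beyond the relevant values of [t], a common tip is either the limit of [r] or a child
    through which the limits of [s] and [r] coincide. *)
Lemma lreach_closed s m r :
  (forall k, exists e, lreach s m e /\ rreach r k e) ->
  exists2 e, rlim r = Some e & lreach s m e.
Proof.
case: r => [b e i t|n t] sr.
  exists e => //.
  case: s sr => [e0|h] sr.
    have [x [sx [xe|[xe xb xi kt]]]] := sr (t e0.1 + t (par (~~ b) e0.1)).+1.
      by rewrite -xe.
    case: sx => [xe0|[xe0 [b' [b'x mx]]]].
      by rewrite xe0 in kt; lia.
    have [bb'|bb'] := eqVneq b' b.
      have -> : e = e0.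
        rewrite [e]surjective_pairing [e0]surjective_pairing.
        by rewrite -xb -b'x bb'; congr pair; lia.
      by left.
    have bE : b' = ~~ b by case: (b) (b') bb' => [] [].
    by rewrite -bE b'x in kt; lia.
  have [x [[mx xh] [xe|[xe xb xi kt]]]] := sr (t (par (~~ b) (h e.2.+1))).+1.
    by rewrite -xe.
  by rewrite xh xe in kt; lia.
exfalso; case: s sr => [e0|h] sr.
  have [x [sx [xn xt]]] := sr (t e0.1 + t (par false e0.1)).+1.
  case: sx => [xe0|[xe0 [b' [b'x mx]]]].
    by have := (xt false).1; rewrite xe0; lia.
  by have := (xt b').1; rewrite b'x; lia.
have [x [[mx xh] [xn /(_ false)[kt _]]]] := sr (t (par false (h n.+1))).+1.
by rewrite xh xn in kt; lia.
Qed.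

(** Levels in [rreach r k] are bounded, and so are the numbers its tips give to [e0], by [i] or by
    [t e0.1]; hence a large [m] leaves only [e0]. *)
Lemma rreach_closed r k s :
  (forall m, exists e, rreach r k e /\ lreach s m e) ->
  exists2 e, llim s = Some e & rreach r k e.
Proof.
case: s => [e0|h] rs; last first.
  exfalso; case: r rs => [b e i t|n t] rs.
    have [x [rx [mx _]]] := rs e.2.+2.
    by case: rx => [xe|[xe _ _ _ _]]; rewrite xe in mx; lia.
  have [x [[xn _] [mx _]]] := rs n.+2.
  by rewrite xn in mx; lia.
exists e0 => //; case: r rs => [b e i t|n t] rs.
  have [x [rx [<- //|[xe0 [b' [b'x mx]]]]]] :=
    rs (i + t e0.1 + num false e.1 + num true e.1).+1.
  exfalso; case: rx => [xe|[xe xb xi kt it]].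
    by move: mx; rewrite xe; case: (b'); lia.
  have [bb'|bb'] := eqVneq b' b.
    by move: mx; rewrite bb' xi; lia.
  have bE : b' = ~~ b by case: (b) (b') bb' => [] [].
  by rewrite -bE b'x in it; lia.
have [x [[xn xt] [<- //|[xe0 [b' [b'x mx]]]]]] := rs (t e0.1).+1.
by have := (xt b').2; rewrite b'x; lia.
Qed.

Lemma lfan_sober : sober_space (scott (fan lshape)).
Proof.
apply: fan_sober => K cK [e1 [e2 [Ke1 Ke2 e12]]].
(* Otherwise a choice [h] of tips of [K] at the occupied levels gives a chain [LLevels h] forcing
   the top as limit. *)
have [n Kn] : exists n, forall e, K e -> (e.2 <= n)%N.
  apply: contrapT => unb.
  have /choice[h hK] n : exists z, (exists y, K (y, n)) -> K (z, n).
    by have [[y Ky]|no] := pselect (exists y, K (y, n)); [exists y|exists e1.1].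
  have [m|e] := cK (LLevels h); last by [].
  apply: contrapT => nK; apply: unb; exists m => -[z n] Kzn /=.
  rewrite leqNgt; apply/negP => mn; apply: nK.
  exists (h n, n) => /=; first by apply: hK; exists z.
  by split=> //; exact: ltnW.
have [e Ke emax] : exists2 e, K e & forall x, K x -> (x.2 <= e.2)%N.
  elim: n Kn => [|n IH] Kn.
    by exists e1 => // x /Kn; case: (x.2).
  have [[e [Ke en]]|no] := pselect (exists e, K e /\ e.2 = n.+1).
    by exists e => //; rewrite en.
  apply: IH => x Kx; have := Kn x Kx; rewrite leq_eqVlt => /orP[/eqP xn|//].
  by case: no; exists x.
exists [set e], (~` [set e]); split.
- by exists e.
- have [e1e|e1e] := pselect (e1 = e); last by exists e1.
  by exists e2; split=> // e2e; apply: e12; rewrite e1e.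
- by rewrite setICr.
- move=> W [->|->] s x sx /= xe.
    exists 0%N => y [+ Ky]; case: s sx => //= e' [->]; rewrite xe.
    by move=> [//|[ye _]]; have := emax y Ky; rewrite ye ltnn.
  have [m ms] : exists m, ~ lreach s m e.
    apply: contrapT => no; apply: xe.
    have se : forall m, lreach s m e.
      by move=> m; apply: contrapT => sm; apply: no; exists m.
    by move: sx; rewrite /= (iffRL (llimP s e) se) => -[].
  by exists m => y [sy _] ye; apply: ms; rewrite -ye.
Qed.

Section Coloring.
Variable S : nat -> seq code.

(* [colored e e' n z]: the node [e] is reached from [(z, n)] by passing
   repeatedly to the only parent lying in [S], without meeting [e'] before. *)
Fixpoint colored (e e' : node) (n : nat) (z : code) : Prop :=
  (z, n) = e \/ (z, n) <> e' /\
  if n is n'.+1 then exists b, [/\ par b z \in S n', par (~~ b) z \notin S n' &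
    colored e e' n' (par b z)] else False.

(** The path is determined by its start, so it cannot meet each of [e] and [e'] before the other. *)
Lemma colored_disjoint e e' n z : e <> e' ->
  colored e e' n z -> colored e' e n z -> False.
Proof.
move=> ee'; elim: n z => [|n IH] z /=.
  by move=> [->|[//]] [//|[//]].
move=> [ze|[ze' [b [bS nbS cb]]]] [ze2|[ze3 [b' [b'S nb'S cb']]]].
- by apply: ee'; rewrite -ze.
- by [].
- by [].
- have [bb|bb] := eqVneq b' b; first by rewrite bb in cb'; exact: IH cb cb'.
  have bE : b' = ~~ b by case: (b) (b') bb => [] [].
  by rewrite bE in b'S; rewrite b'S in nbS.
Qed.

End Coloring.

Lemma rfan_sober : sober_space (scott (fan rshape)).
Proof.
apply: fan_sober => K cK [e1 [e2 [Ke1 Ke2 e12]]].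
have /choice[S SK] n : exists S : seq code, forall v, K (v, n.+1) ->
    exists b, par b v \in S.
  pose Q v := K (v, n.+1).
  have [|S SQ] := @finite_coverI code code Q
      (fun v => [:: par false v; par true v])
      (fun v => maxn (num false v) (num true v)).
    move=> t; apply: contrapT => nk; have [k|e] := cK (RLevel n t); last by [].
    apply: contrapT => nK; apply: nk; exists k => v Kv tv; apply: nK.
    exists (v, n.+1) => //=; split=> // b.
    have [] := tv (par b v); first by case: (b); rewrite !inE eqxx ?orbT.
    by move=> -> /(leq_trans _) ->//; case: (b); rewrite leq_max leqnn ?orbT.
  exists S => v /SQ[x]; rewrite !inE => /orP[] /eqP ->.
    by exists false.
  by exists true.
pose U e e' : set node := [set x | colored S e e' x.2 x.1].
have Ue e e' : U e e' e by case: e => z [|n]; left.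
have Uopen e e' s x : rlim s = Some x -> U e e' x ->
    exists m, rreach s m `&` K `<=` U e e'.
  case: s => // b [z n] i t [<-] Uz.
  (* The maximum forces the other parent out of [S n], so the path from [v] goes to [z]; the second
     summand ensures [v] is not [e']. *)
  exists (\max_(w <- S n) t w + t (par (~~ b) e'.1)).+1 => -[v n'] [].
  case=> [[-> ->] //|[/= -> vz _ kt _] Kv].
  right; split; first by move=> ve; rewrite -ve /= in kt; lia.
  have nb : par (~~ b) v \notin S n.
    apply/negP => vS; move: kt; rewrite ltnNge => /negP; apply.
    apply: leq_trans (leq_addr _ _).
    exact: (@leq_bigmax_seq _ _ predT t _ vS isT).
  exists b; split=> //; last by rewrite vz.
  have [b' b'S] := SK n v Kv; have [bb|bb] := eqVneq b' b; first by rewrite -bb.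
  have bE : b' = ~~ b by case: (b) (b') bb => [] [].
  by rewrite bE in b'S; rewrite b'S in nb.
exists (U e1 e2), (U e2 e1); split; [by exists e1|by exists e2| |].
  by apply/seteqP; split=> // x [/colored_disjoint]; exact.
by move=> W [->|->]; exact: Uopen.
Qed.

(** * Scott closed sets of a binary product *)

Section BinaryProduct.
Context (P Q : dcpo).

Definition factor (b : bool) : dcpo := if b then P else Q.

Definition dpair (x : P) (y : Q) : dcpo_prod factor :=
  fun b => if b return factor b then x else y.

Lemma dpair_eta (f : dcpo_prod factor) : f = dpair (f true) (f false).
Proof. by apply: functional_extensionality_dep => -[]. Qed.

Lemma dpair_le x y x' y' :
  (dpair x y <= dpair x' y') <-> (x <= x' /\ y <= y').
Proof.
split=> [/dcpo_prod_leP H|[xx' yy']]; first by split; [exact: (H true)|exact: (H false)].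
by apply/dcpo_prod_leP => -[].
Qed.

(** For the converse the supremum is taken one coordinate at a time: for fixed [f] in [D], the first
    coordinates of members above [f] already have supremum [s true]. *)
Lemma scott_closed_dpair (A : set (dcpo_prod factor)) : scott_closed A <->
  (forall y, scott_closed [set x | A (dpair x y)]) /\
  (forall x, scott_closed [set y | A (dpair x y)]).
Proof.
split=> [[low lub]|[Al Ar]].
  split=> z; split.
  - by move=> x x' xx'; apply: low; apply/dpair_le.
  - move=> D s [[x0 Dx0] dD] [ub lb] DA.
    apply: (lub ((dpair^~ z) @` D)); last by move=> _ [x /DA Ax <-].
      split=> [|_ _ [x Dx <-] [x' Dx' <-]]; first by exists (dpair x0 z), x0.
      have [u [Du xu x'u]] := dD x x' Dx Dx'.
      by exists (dpair u z); split; [exists u|apply/dpair_le|apply/dpair_le].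
    split=> [_ [x /ub xs <-]|f fD]; first exact/dpair_le.
    have fx x : D x -> x <= f true /\ z <= f false.
      by move=> Dx; apply/dpair_le; rewrite -dpair_eta; apply: fD; exists x.
    rewrite (dpair_eta f); apply/dpair_le; split; last exact: (fx x0 Dx0).2.
    by apply: lb => x /fx[].
  - by move=> y y' yy'; apply: low; apply/dpair_le.
  - move=> D s [[y0 Dy0] dD] [ub lb] DA.
    apply: (lub (dpair z @` D)); last by move=> _ [y /DA Ay <-].
      split=> [|_ _ [y Dy <-] [y' Dy' <-]]; first by exists (dpair z y0), y0.
      have [u [Du yu y'u]] := dD y y' Dy Dy'.
      by exists (dpair z u); split; [exists u|apply/dpair_le|apply/dpair_le].
    split=> [_ [y /ub ys <-]|f fD]; first exact/dpair_le.
    have fy y : D y -> z <= f true /\ y <= f false.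
      by move=> Dy; apply/dpair_le; rewrite -dpair_eta; apply: fD; exists y.
    rewrite (dpair_eta f); apply/dpair_le; split; first exact: (fy y0 Dy0).1.
    by apply: lb => y /fy[].
have low f g : f <= g -> A g -> A f.
  rewrite (dpair_eta f) (dpair_eta g) => /dpair_le[fg1 fg2] Ag.
  by apply: (Al _).1 fg1 _; exact: (Ar _).1 fg2 Ag.
split=> // D s dD ls DA.
have sl b : isLub [set f b | f in D] (s b).
  exact: (iffLR (scott_continuousP _) (@cts_fun _ _ (dcpo_proj factor b))).
have {}Al f : D f -> A (dpair (s true) (f false)).
  move=> Df.
  apply: ((Al (f false)).2 [set g true | g in [set g | D g /\ f <= g]]).
  - split; first by exists (f true), f.
    move=> _ _ [g [Dg fg] <-] [h [Dh fh] <-].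
    have [k [Dk /[dup] gk /dcpo_prod_leP gk' /dcpo_prod_leP hk]] := dD.2 g h Dg Dh.
    exists (k true); split; [|exact: gk'|exact: hk].
    by exists k => //; split=> //; exact: le_trans fg gk.
  - split=> [_ [g [Dg _] <-]|b bD]; first by apply: (sl true).1; exists g.
    apply: (sl true).2 => _ [g Dg <-].
    have [k [Dk fk /dcpo_prod_leP gk]] := dD.2 f g Df Dg.
    by apply: le_trans (gk true) _; apply: bD; exists k.
  - move=> _ [g [Dg fg] <-]; apply: low (DA g Dg).
    rewrite [leRHS]dpair_eta; apply/dpair_le; split=> //.
    exact: (iffLR (dcpo_prod_leP f g) fg false).
rewrite (dpair_eta s); apply: ((Ar (s true)).2 [set f false | f in D]) (sl false) _.
  case: (dD) => -[f Df] dD2; split; first by exists (f false), f.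
  move=> _ _ [g Dg <-] [h Dh <-].
  have [k [Dk /dcpo_prod_leP gk /dcpo_prod_leP hk]] := dD2 g h Dg Dh.
  by exists (k false); split; [exists k|exact: gk|exact: hk].
by move=> _ [f Df <-]; exact: Al.
Qed.

End BinaryProduct.

(** * The diagonal in the product *)

Local Notation L := (fan lshape : dcpo).
Local Notation R := (fan rshape : dcpo).

Definition diagonal : set (dcpo_prod (factor L R)) :=
  [set f : dcpo_prod (factor L R) | exists e : node,
     (f true : L) <= Tip (F := lshape) e /\ (f false : R) <= Tip (F := rshape) e].

Lemma diagonal_closed : scott_closed diagonal.
Proof.
apply/scott_closed_dpair; split=> z; apply/fan_scott_closedP; split.
- by move=> x x' xx' [e [/= x'e ze]]; exists e; split=> //; exact: le_trans x'e.
- move=> s; case: z => [|e|r k] sD.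
  + by have [e [_ /fan_leE]] := sD 0%N.
  + exists e; split=> /=; last exact: (@lexx _ R).
    have /(iffRL (llimP s e)) se : forall m, lreach s m e.
      by move=> m; have [e' [/= /fan_leE + /fan_leE /= ->]] := sD m.
    by rewrite /fan_lim /= se; exact: (@lexx _ L).
  + have [|e se re] := @rreach_closed r k s.
      by move=> m; have [e [/fan_leE ? /fan_leE ?]] := sD m; exists e.
    exists e => /=; split; last exact/fan_leE.
    by rewrite /fan_lim /= se; exact: (@lexx _ L).
- by move=> y y' yy' [e [/= ze y'e]]; exists e; split=> //; exact: le_trans y'e.
- move=> r; case: z => [|e|s m] rD.
  + by have [e [/fan_leE]] := rD 0%N.
  + exists e; split=> /=; first exact: (@lexx _ L).
    have /(iffRL (rlimP r e)) re : forall m, rreach r m e.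
      by move=> m; have [e' [/= /fan_leE /= -> /fan_leE]] := rD m.
    by rewrite /fan_lim /= re; exact: (@lexx _ R).
  + have [|e re se] := @lreach_closed s m r.
      by move=> k; have [e [/fan_leE ? /fan_leE ?]] := rD k; exists e.
    exists e => /=; split; first exact/fan_leE.
    by rewrite /fan_lim /= re; exact: (@lexx _ R).
Qed.

Definition dtip (e : node) : dcpo_prod (factor L R) :=
  dpair (Tip (F := lshape) e : L) (Tip (F := rshape) e : R).

Lemma diagonal_dtip e : diagonal (dtip e).
Proof. by exists e; split; [exact: (@lexx _ L)|exact: (@lexx _ R)]. Qed.

Lemma dtip_grows (B : set (dcpo_prod (factor L R))) : scott_closed B ->
  grows [set e | ~ B (dtip e)].
Proof.
move=> cB z n /= nBz; have [low _] := cB.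
have /scott_closed_dpair[/(_ (Tip (F := rshape) (z, n)))/fan_scott_closedP[_ Bl] Br] := cB.
have [m nBm] : exists m, ~ B (dpair (Stem (F := lshape) (LNode (z, n)) m : L)
    (Tip (F := rshape) (z, n) : R)).
  apply: contrapT => no; apply: nBz; apply: (Bl (LNode (z, n))) => m.
  by apply: contrapT => nBm; apply: no; exists m.
exists m => b.
(* [Q] collects the exceptional children; each [t] indexes a chain of [R] to [(z, n)], one term of
   which lies below none of them. *)
pose Q v := [/\ par b v = z, num b v = m & B (dtip (v, n.+1))].
have [|S SQ] := @finite_coverI code code Q (fun v => [:: par (~~ b) v]) (num (~~ b)).
  move=> t; pose r := RNode b (z, n) m t.
  have [k nBk] : exists k, ~ B (dpair (Stem (F := lshape) (LNode (z, n)) m : L)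
      (Stem (F := rshape) r k : R)).
    apply: contrapT => no; apply: nBm.
    have /fan_scott_closedP[_ Br'] := Br (Stem (F := lshape) (LNode (z, n)) m).
    apply: (Br' r) => k.
    by apply: contrapT => nBk; apply: no; exists k.
  exists k => v [vz vm Bv] tv; apply: nBk; apply: low Bv; apply/dpair_le.
  have [kt nt] := tv _ (mem_head _ _).
  split; apply/fan_leE => /=; right; split=> //.
  by exists b; rewrite vz vm.
exists S => v vz vm vS Bv; have [|x] := SQ v; first by split.
by rewrite inE => /eqP -> /(negP vS).
Qed.

Lemma diagonal_irreducible :
  irreducible_set (diagonal : set (scott (dcpo_prod (factor L R)))).
Proof.
split=> [|B C /scott_closedP cB /scott_closedP cC ABC].
  by exists (dtip (fun=> 0%N, 0%N)); exact: diagonal_dtip.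
apply: contrapT => no.
have out (D : set (dcpo_prod (factor L R))) : scott_closed D ->
    ~ diagonal `<=` D -> [set e | ~ D (dtip e)] !=set0.
  move=> [low _] nD; apply: contrapT => D0; apply: nD => f [e [fl fr]].
  apply: contrapT => nDf; apply: D0; exists e => De; apply: nDf.
  by apply: low De; rewrite [leLHS]dpair_eta; exact/dpair_le.
have [||e [nBe nCe]] := grows_meet (dtip_grows cB) (dtip_grows cC).
- by apply: out => // AB; apply: no; left.
- by apply: out => // AC; apply: no; right.
- by case: (ABC _ (diagonal_dtip e)).
Qed.

Lemma product_not_sober : ~ sober_space (scott (dcpo_prod (factor L R))).
Proof.
move=> sP; have [f fA] := scott_sober_point sP diagonal_closed diagonal_irreducible.
have : diagonal f by rewrite fA; exact: (@lexx _ (dcpo_prod (factor L R))).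
case=> e [fe _].
(* A generator would lie below one diagonal pair, and distinct tips are incomparable. *)
have tip_e e' : e' = e.
  have : [set g | g <= f] (dtip e') by rewrite -fA; exact: diagonal_dtip.
  move=> /dcpo_prod_leP/(_ true)/le_trans/(_ fe).
  by move=> /fan_leE.
by have := tip_e (e.1, e.2.+1); case: e {fe tip_e} => z n [] /esym/n_Sn.
Qed.

Theorem mainTheorem4 :
  ~ closed_under_products sober_dcpo /\ ~ reflective sober_dcpo.
Proof.
have ncp : ~ closed_under_products sober_dcpo.
  move=> /(_ _ _ _ _ _ (@dcpo_prod_is_product bool (factor L R))) cp.
  by apply: product_not_sober; apply: cp => -[]; [exact: lfan_sober|exact: rfan_sober].
by split=> // /reflective_closed_under_products.
Qed.
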